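(* Let $H\in\mathcal{C}$ be a bialgebra, let $A\in\mathcal{D}$ be a measuring on $\overline{H}$, and let $\sigma:\overline{H}\otimes\overline{H}\to A$ be a morphism in $\mathcal{D}$. Assume that $\sigma$ is convolution invertible. Then $\sigma$ is a cocycle if and only if $\mu_\sigma:(A\otimes\overline{H})\otimes(A\otimes\overline{H})\to A\otimes\overline{H}$ is an associative multiplication with unit $\eta_A\otimes\overline{\eta}$.
   Context: Setting. $\mathcal{C},\mathcal{D}$ are strict monoidal categories, $\mathcal{D}$ has equalizers, $\mathbf{1}$ is the unit object of $\mathcal{C}$, and $\overline{\,\cdot\,}:\mathcal{C}\to\mathcal{D}$ is a strict monoidal functor with a left braiding $c$: a family of isomorphisms $c_{X,V}:\overline{X}\otimes V\to V\otimes\overline{X}$ in $\mathcal{D}$ ($X\in\mathcal{C}$, $V\in\mathcal{D}$), natural in $X$ and $V$ (i.e. $c_{Y,W}(\overline{f}\otimes g)=(g\otimes\overline{f})c_{X,V}$ for $f:X\to Y$ in $\mathcal{C}$, $g:V\to W$ in $\mathcal{D}$), with $c_{X\otimes Y,V}=(c_{X,V}\otimes\mathrm{id})(\mathrm{id}\otimes c_{Y,V})$ and $c_{X,V\otimes W}=(\mathrm{id}\otimes c_{X,W})(c_{X,V}\otimes\mathrm{id})$. Composition is written as juxtaposition. Algebras (associative, unital; $\mu_A,\eta_A$) and coalgebras (coassociative, counital; $\Delta_C,\varepsilon_C$) in a monoidal category are defined as usual. If $A$ is a coalgebra in $\mathcal{D}$ and $B$ a coalgebra in $\mathcal{C}$,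 then $\overline{B}\otimes A$ is a coalgebra in $\mathcal{D}$ with counit $\overline{\varepsilon_B}\otimes\varepsilon_A$ and comultiplication $(\mathrm{id}\otimes c_{B,A}\otimes\mathrm{id})(\overline{\Delta_B}\otimes\Delta_A)$. For $f,g:C\to A$ from a coalgebra to an algebra, $f*g=\mu_A(f\otimes g)\Delta_C$; $f$ is convolution invertible if there is a morphism $f^-:C\to A$ with $f*f^-=\eta_A\varepsilon_C=f^-*f$. A bialgebra is an object $H\in\mathcal{C}$ that is an algebra and a coalgebra in $\mathcal{C}$, with structure morphisms $\mu,\eta,\Delta,\varepsilon$, such that $\overline{\mu}:\overline{H}\otimes\overline{H}\to\overline{H}$ and $\overline{\eta}:\overline{\mathbf{1}}\to\overline{H}$ are coalgebra morphisms in $\mathcal{D}$. Write $\Delta_{\overline{H}\otimes\overline{H}}=(\mathrm{id}\otimes c_{H,\overline{H}}\otimes\mathrm{id})(\overline{\Delta}\otimes\overline{\Delta})$. A measuring on $\overline{H}$ is an algebra $A\in\mathcal{D}$ with a morphism $\nu_A:\overline{H}\otimes A\to A$ such that $\nu_A(\overline{\eta}\otimes\mathrm{id}_A)=\mathrm{id}_A$, $\nu_A(\mathrm{id}\otimes\eta_A)=\eta_A\overline{\varepsilon}$ and $\nu_A(\mathrm{id}\otimes\mu_A)=\mu_A(\nu_A\otimes\nu_A)(\mathrm{id}\otimes c_{H,A}\otimes\mathrm{id})(\overline{\Delta}\otimes\mathrm{id}_A\otimes\mathrm{id}_A)$. Put $c^\nu_{H,A}=(\nu_A\otimes\mathrm{id})(\mathrm{id}\otimes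 c_{H,A})(\overline{\Delta}\otimes\mathrm{id}):\overline{H}\otimes A\to A\otimes\overline{H}$. For a morphism $\sigma:\overline{H}\otimes\overline{H}\to A$ in $\mathcal{D}$ put $\hat\sigma=(\sigma\otimes\overline{\mu})\Delta_{\overline{H}\otimes\overline{H}}:\overline{H}\otimes\overline{H}\to A\otimes\overline{H}$ and $\mu_\sigma=(\mu_A\otimes\mathrm{id})(\mu_A\otimes\hat\sigma)(\mathrm{id}\otimes c^\nu_{H,A}\otimes\mathrm{id})$. $\sigma$ is a (two-)cocycle if it is convolution invertible and (i) $\mu_A(\mathrm{id}\otimes\sigma)(\hat\sigma\otimes\mathrm{id}_{\overline{H}})=\mu_A(\mathrm{id}\otimes\sigma)(c^\nu_{H,A}\otimes\mathrm{id})(\mathrm{id}_{\overline{H}}\otimes\hat\sigma)$, (ii) $\mu_A(\mathrm{id}\otimes\nu_A)(\hat\sigma\otimes\mathrm{id}_A)=\mu_A(\mathrm{id}\otimes\sigma)(c^\nu_{H,A}\otimes\mathrm{id})(\mathrm{id}_{\overline{H}}\otimes c^\nu_{H,A})$, (iii) $\sigma(\overline{\eta}\otimes\overline{\eta})=\eta_A$. *)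

(* Defs.v *)
Set Implicit Arguments.
Unset Strict Implicit.
Unset Printing Implicit Defensive.

Declare Scope moncat_scope.
Delimit Scope moncat_scope with moncat.
Local Open Scope moncat_scope.

Reserved Notation "g ∘ f" (at level 40, left associativity).
Reserved Notation "g • f" (at level 40, left associativity).
Reserved Notation "X ⊗ Y" (at level 35, right associativity).
Reserved Notation "f ≡ g" (at level 70, no associativity).

Record category := Category {
  ob :> Type;
  hom : ob -> ob -> Type;
  idm : forall X, hom X X;
  comp : forall X Y Z, hom Y Z -> hom X Y -> hom X Z;
  comp_idl : forall X Y (f : hom X Y), comp (idm Y) f = f;
  comp_idr : forall X Y (f : hom X Y), comp f (idm X) = f;
  compA : forall W X Y Z (h : hom Y Z) (g : hom X Y) (f : hom W X),
    comp h (comp g f) = comp (comp h g) f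
}.
Arguments hom {c} X Y.
Arguments idm {c} X.
Arguments comp {c X Y Z} g f.
Notation "g ∘ f" := (comp g f) : moncat_scope.

Definition is_iso (C : category) (X Y : C) (f : hom X Y) : Prop :=
  exists g : hom Y X, g ∘ f = idm X /\ f ∘ g = idm Y.

Definition has_equalizers (C : category) : Prop :=
  forall (X Y : C) (f g : hom X Y),
  exists (E : C) (e : hom E X),
    f ∘ e = g ∘ e /\
    forall (Z : C) (h : hom Z X), f ∘ h = g ∘ h ->
      exists! k : hom Z E, e ∘ k = h.

(* In a strict monoidal category objects such as (X ⊗ Y) ⊗ Z and X ⊗ (Y ⊗ Z)
   are equal but, in type theory, not convertible.  [eqm e] is the identity
   morphism seen with propositionally equal source and target. *)
Definition eqm (C : category) (X Y : C) (e : X = Y) : hom X Y :=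
  match e with eq_refl => idm X end.

(* Equality of morphisms whose sources (resp. targets) are only propositionally
   equal objects. *)
Definition same_mor (C : category) (X Y X' Y' : C)
    (f : hom X Y) (g : hom X' Y') : Prop :=
  exists (p : X = X') (q : Y = Y'), eqm q ∘ f = g ∘ eqm p.
Notation "f ≡ g" := (same_mor f g) : moncat_scope.

Record strict_moncat := StrictMoncat {
  mcat :> category;
  one : mcat;
  ten : mcat -> mcat -> mcat;
  tenf : forall X X' Y Y' : mcat,
    hom X X' -> hom Y Y' -> hom (ten X Y) (ten X' Y');
  tenf_id : forall X Y, tenf (idm X) (idm Y) = idm (ten X Y);
  tenf_comp : forall (X X' X'' Y Y' Y'' : mcat)
      (g : hom X' X'') (f : hom X X') (g' : hom Y' Y'') (f' : hom Y Y'),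
    tenf (g ∘ f) (g' ∘ f') = tenf g g' ∘ tenf f f';
  tenA : forall X Y Z, ten (ten X Y) Z = ten X (ten Y Z);
  ten1X : forall X, ten one X = X;
  tenX1 : forall X, ten X one = X;
  tenfA : forall (X X' Y Y' Z Z' : mcat)
      (f : hom X X') (g : hom Y Y') (h : hom Z Z'),
    tenf (tenf f g) h ≡ tenf f (tenf g h);
  tenf1f : forall (X X' : mcat) (f : hom X X'), tenf (idm one) f ≡ f;
  tenff1 : forall (X X' : mcat) (f : hom X X'), tenf f (idm one) ≡ f
}.
Arguments one {s}.
Arguments ten {s} X Y.
Arguments tenf {s X X' Y Y'} f g.
Notation "X ⊗ Y" := (ten X Y) : moncat_scope.
Notation "f ⊗' g" := (tenf f g)
  (at level 35, right associativity) : moncat_scope.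

Record strict_monfunctor (C D : strict_moncat) := StrictMonfunctor {
  fob :> C -> D;
  fmap : forall X Y : C, hom X Y -> hom (fob X) (fob Y);
  fmap_id : forall X : C, fmap (idm X) = idm (fob X);
  fmap_comp : forall (X Y Z : C) (g : hom Y Z) (f : hom X Y),
    fmap (g ∘ f) = fmap g ∘ fmap f;
  fob_one : fob one = one;
  fob_ten : forall X Y : C, fob (X ⊗ Y) = fob X ⊗ fob Y;
  fmap_ten : forall (X X' Y Y' : C) (f : hom X X') (g : hom Y Y'),
    fmap (f ⊗' g) ≡ fmap f ⊗' fmap g
}.
Arguments fmap {C D} F {X Y} f : rename.

(* [eq_ob X Y] is found automatically, by normalizing both objects with the
   strictness equations; which proof is found is irrelevant. *)
Class eq_ob (C : category) (X Y : C) : Prop := eq_ob_eq : X = Y.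
Arguments eq_ob_eq {C X Y _}.
Ltac strictness :=
  lazymatch goal with |- @eq_ob _ ?X ?Y => change (X = Y) end;
  repeat first [ rewrite fob_ten | rewrite fob_one
               | rewrite tenA | rewrite ten1X | rewrite tenX1 ];
  reflexivity.
#[export] Hint Extern 0 (eq_ob _ _) => strictness : typeclass_instances.

(* The same morphism, with source and target replaced by equal objects. *)
Definition cast (C : category) (X Y X' Y' : C)
    {p : eq_ob X' X} {q : eq_ob Y Y'} (f : hom X Y) : hom X' Y' :=
  eqm (eq_ob_eq (X := Y) (Y := Y')) ∘ f ∘ eqm (eq_ob_eq (X := X') (Y := X)).
Arguments cast {C X Y X' Y' p q} f.

(* Composition of morphisms that are composable up to strictness. *)
Definition scomp (C : category) (X Y Y' Z : C)
    (g : hom Y' Z) (f : hom X Y) {e : eq_ob Y Y'} : hom X Z :=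
  g ∘ eqm (eq_ob_eq (X := Y) (Y := Y')) ∘ f.
Arguments scomp {C X Y Y' Z} g f {e}.
Notation "g • f" := (scomp g f) : moncat_scope.

Record left_braiding (C D : strict_moncat) (F : strict_monfunctor C D) :=
  LeftBraiding {
  braid :> forall (X : C) (V : D), hom (F X ⊗ V) (V ⊗ F X);
  braid_iso : forall X V, is_iso (braid X V);
  braid_nat : forall (X Y : C) (V W : D) (f : hom X Y) (g : hom V W),
    braid Y W ∘ (fmap F f ⊗' g) = (g ⊗' fmap F f) ∘ braid X V;
  braid_tenl : forall (X Y : C) (V : D),
    braid (X ⊗ Y) V ≡ (braid X V ⊗' idm (F Y)) • (idm (F X) ⊗' braid Y V);
  braid_tenr : forall (X : C) (V W : D),
    braid X (V ⊗ W) ≡ (idm V ⊗' braid X W) • (braid X V ⊗' idm W)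
}.

Section Structures.
Variable C : strict_moncat.

Record alg_data (A : C) := AlgData { mul : hom (A ⊗ A) A; eta : hom one A }.

Record is_algebra (A : C) (m : alg_data A) : Prop := IsAlgebra {
  mul_assoc : mul m ∘ (mul m ⊗' idm A) ≡ mul m ∘ (idm A ⊗' mul m);
  mul_unitl : mul m ∘ (eta m ⊗' idm A) ≡ idm A;
  mul_unitr : mul m ∘ (idm A ⊗' eta m) ≡ idm A
}.

Record coalg_data (A : C) :=
  CoalgData { delta : hom A (A ⊗ A); eps : hom A one }.

Record is_coalgebra (A : C) (d : coalg_data A) : Prop := IsCoalgebra {
  delta_coassoc : (delta d ⊗' idm A) ∘ delta d ≡ (idm A ⊗' delta d) ∘ delta d;
  delta_counitl : (eps d ⊗' idm A) ∘ delta d ≡ idm A;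
  delta_counitr : (idm A ⊗' eps d) ∘ delta d ≡ idm A
}.

Record is_coalg_mor (A B : C) (dA : coalg_data A) (dB : coalg_data B)
    (f : hom A B) : Prop := IsCoalgMor {
  coalg_mor_delta : delta dB ∘ f = (f ⊗' f) ∘ delta dA;
  coalg_mor_eps : eps dB ∘ f = eps dA
}.

Definition coalg_one : coalg_data one := CoalgData (cast (idm one)) (idm one).

Record algebra := Algebra {
  alg_ob :> C;
  alg_str : alg_data alg_ob;
  algP : is_algebra alg_str
}.

Definition convolution (X : C) (d : coalg_data X) (A : algebra)
    (f g : hom X A) : hom X A :=
  mul (alg_str A) ∘ (f ⊗' g) ∘ delta d.

Definition conv_invertible (X : C) (d : coalg_data X) (A : algebra)
    (f : hom X A) : Prop :=
  exists f' : hom X A,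
    convolution d f f' = eta (alg_str A) ∘ eps d /\
    convolution d f' f = eta (alg_str A) ∘ eps d.

End Structures.

Section Braided.
Variables (C D : strict_moncat) (F : strict_monfunctor C D).
Variable c : left_braiding F.

Definition coalg_map (B : C) (d : coalg_data B) : coalg_data (F B) :=
  CoalgData (cast (fmap F (delta d))) (cast (fmap F (eps d))).

Definition coalg_ten (B : C) (dB : coalg_data B) (A : D) (dA : coalg_data A) :
    coalg_data (F B ⊗ A) :=
  CoalgData
    (cast ((idm (F B) ⊗' c B A ⊗' idm A) • (fmap F (delta dB) ⊗' delta dA)))
    (cast (fmap F (eps dB) ⊗' eps dA)).

Record bialgebra := Bialgebra {
  bialg_ob :> C;
  bialg_alg : alg_data bialg_ob;
  bialg_coalg : coalg_data bialg_ob;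
  bialg_algP : is_algebra bialg_alg;
  bialg_coalgP : is_coalgebra bialg_coalg;
  bialg_mulP :
    is_coalg_mor (coalg_ten bialg_coalg (coalg_map bialg_coalg))
      (coalg_map bialg_coalg)
      (cast (fmap F (mul bialg_alg)) : hom (F bialg_ob ⊗ F bialg_ob) (F bialg_ob));
  bialg_etaP :
    is_coalg_mor (coalg_map (coalg_one C)) (coalg_map bialg_coalg)
      (fmap F (eta bialg_alg))
}.

Section Bialgebra.
Variable H : bialgebra.

Definition muH : hom (F H ⊗ F H) (F H) := cast (fmap F (mul (bialg_alg H))).
Definition etaH : hom (F one) (F H) := fmap F (eta (bialg_alg H)).
Definition deltaH : hom (F H) (F H ⊗ F H) := delta (coalg_map (bialg_coalg H)).
Definition epsH : hom (F H) one := eps (coalg_map (bialg_coalg H)).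

Definition coalgHH : coalg_data (F H ⊗ F H) :=
  coalg_ten (bialg_coalg H) (coalg_map (bialg_coalg H)).

Record measuring := Measuring {
  meas_alg :> algebra D;
  nu : hom (F H ⊗ meas_alg) meas_alg;
  nu_etaH : nu ∘ (etaH ⊗' idm (alg_ob meas_alg)) ≡ idm (alg_ob meas_alg);
  nu_eta : nu ∘ (idm (F H) ⊗' eta (alg_str meas_alg))
           ≡ eta (alg_str meas_alg) ∘ epsH;
  nu_mul : nu ∘ (idm (F H) ⊗' mul (alg_str meas_alg))
           ≡ mul (alg_str meas_alg) ∘ (nu ⊗' nu)
               • (idm (F H) ⊗' c H meas_alg ⊗' idm (alg_ob meas_alg))
               • (deltaH ⊗' idm (alg_ob meas_alg) ⊗' idm (alg_ob meas_alg))
}.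

Section Measuring.
Variable A : measuring.
Local Notation muA := (mul (alg_str A)).
Local Notation etaA := (eta (alg_str A)).
Local Notation idA := (idm (alg_ob A)).
Local Notation idH := (idm (F H)).

Definition braid_nu : hom (F H ⊗ A) (A ⊗ F H) :=
  (nu A ⊗' idH) • (idH ⊗' c H A) • (deltaH ⊗' idA).

Variable sigma : hom (F H ⊗ F H) A.

Definition sigma_hat : hom (F H ⊗ F H) (A ⊗ F H) :=
  (sigma ⊗' muH) ∘ delta coalgHH.

Definition mu_sigma : hom ((A ⊗ F H) ⊗ (A ⊗ F H)) (A ⊗ F H) :=
  cast ((muA ⊗' idH) • (muA ⊗' sigma_hat) • (idA ⊗' braid_nu ⊗' idH)).

Definition eta_sigma : hom one (A ⊗ F H) := cast (etaA ⊗' etaH).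

Record is_cocycle : Prop := IsCocycle {
  cocycle_conv : conv_invertible coalgHH sigma;
  cocycle_sigma :
    muA ∘ (idA ⊗' sigma) • (sigma_hat ⊗' idH)
    ≡ muA ∘ (idA ⊗' sigma) • (braid_nu ⊗' idH) • (idH ⊗' sigma_hat);
  cocycle_nu :
    muA ∘ (idA ⊗' nu A) • (sigma_hat ⊗' idA)
    ≡ muA ∘ (idA ⊗' sigma) • (braid_nu ⊗' idH) • (idH ⊗' braid_nu);
  cocycle_unit : sigma ∘ (etaH ⊗' etaH) ≡ etaA
}.

End Measuring.
End Bialgebra.
End Braided.

(* Main.v *)
(* Identities are proved as equations between string diagrams over the wires A and
   H.  A diagram is interpreted as an untyped arrow of D, so that strictness becomes
   Leibniz equality, and equality up to the interchange law is decided by sorting the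
   boxes of the two diagrams.

   Write s^ for sigma-hat and c^nu for the twisted braiding.  Since mu_H is a coalgebra
   morphism, s^ and c^nu are compatible with Delta, so equations (i) and (ii) of a cocycle,
   which have target A, lift to
     (mu_A H)(A s^)(s^ H) = (mu_A H)(A s^)(c^nu H)(H s^),
     (mu_A H)(A c^nu)(s^ A) = (mu_A H)(A s^)(c^nu H)(H c^nu).
   Together with multiplicativity of c^nu these give associativity of mu_sigma.
   For the unit, (i) evaluated at (h,1,1) and (1,1,h) and (iii) show that
   sigma(-,1) and sigma(1,-) are convolution idempotents; being convolution
   invertible, they are trivial.  Conversely, the lifted equations are
   associativity of mu_sigma on (1h)(1k)(1l) and (1h)(1k)(a1), and applying
   epsilon to the factor H returns (i) and (ii). *)

From Stdlib Require Import List Bool ProofIrrelevance ClassicalEpsilon Setoid Morphisms.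
Import ListNotations.
Require Import Defs.
Set Implicit Arguments.
Unset Strict Implicit.
Unset Printing Implicit Defensive.
Local Open Scope moncat_scope.

(** * Morphisms with bundled source and target *)

Record arrow (C : category) := Arrow { asrc : C; atgt : C; amor : hom asrc atgt }.
Arguments Arrow {C asrc atgt} amor.

Lemma same_morE (C : category) (X Y X' Y' : C) (f : hom X Y) (g : hom X' Y') :
  f ≡ g <-> Arrow f = Arrow g.
Proof.
  split.
  - intros [p [q E]]. destruct p, q. simpl in E.
    rewrite comp_idl, comp_idr in E. now rewrite E.
  - intros E.
    enough (K : forall a b : arrow C, a = b -> amor a ≡ amor b)
      by exact (K _ _ E).
    intros a b []. exists eq_refl, eq_refl. simpl.
    now rewrite comp_idl, comp_idr.
Qed.

(** Bundling loses nothing: by proof irrelevance, the equalities between sources and between targets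
    are reflexivity. *)
Lemma Arrow_inj (C : category) (X Y : C) (f g : hom X Y) :
  Arrow f = Arrow g -> f = g.
Proof.
  intros E. apply same_morE in E. destruct E as [p [q E]].
  rewrite (proof_irrelevance _ p eq_refl), (proof_irrelevance _ q eq_refl) in E.
  simpl in E. now rewrite comp_idl, comp_idr in E.
Qed.

Definition aid (C : category) (X : C) : arrow C := Arrow (idm X).

(* Total: for non-composable arrows the value is the junk [f]. *)
Definition acomp (C : category) (g f : arrow C) : arrow C :=
  match excluded_middle_informative (atgt f = asrc g) with
  | left e => Arrow (amor g ∘ eqm e ∘ amor f)
  | right _ => f
  end.

Section Arrows.
Variable C : category.
Implicit Types f g h : arrow C.

Lemma Arrow_scomp (X Y Y' Z : C) (g : hom Y' Z) (f : hom X Y) (e : eq_ob Y Y') :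
  Arrow (g • f) = acomp (Arrow g) (Arrow f).
Proof.
  unfold acomp, scomp; simpl. destruct excluded_middle_informative as [e'|n].
  - now rewrite (proof_irrelevance _ e' eq_ob_eq).
  - now destruct (n e).
Qed.

Lemma Arrow_comp (X Y Z : C) (g : hom Y Z) (f : hom X Y) :
  Arrow (g ∘ f) = acomp (Arrow g) (Arrow f).
Proof.
  rewrite <- (Arrow_scomp g f (eq_refl : eq_ob Y Y)).
  unfold scomp, eq_ob_eq; simpl. now rewrite comp_idr.
Qed.

Lemma Arrow_cast (X Y X' Y' : C) (p : eq_ob X' X) (q : eq_ob Y Y') (f : hom X Y) :
  Arrow (cast (p := p) (q := q) f) = Arrow f.
Proof.
  unfold cast, eq_ob_eq. unfold eq_ob in p, q. destruct q. subst X'. simpl.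
  now rewrite comp_idl, comp_idr.
Qed.

Lemma asrc_acomp g f : asrc (acomp g f) = asrc f.
Proof. unfold acomp. now destruct excluded_middle_informative. Qed.

Lemma atgt_acomp g f : atgt f = asrc g -> atgt (acomp g f) = atgt g.
Proof. intros e. unfold acomp. now destruct excluded_middle_informative. Qed.

Lemma acompA h g f : atgt f = asrc g -> atgt g = asrc h ->
  acomp h (acomp g f) = acomp (acomp h g) f.
Proof.
  destruct f as [W X f], g as [X' Y g], h as [Y' Z h]; simpl.
  intros e1 e2. subst X' Y'. now rewrite <- !Arrow_comp, compA.
Qed.

Lemma acomp_idl f X : atgt f = X -> acomp (aid X) f = f.
Proof.
  intros <-. destruct f as [X Y f]; simpl. unfold aid.
  now rewrite <- Arrow_comp, comp_idl.
Qed.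

Lemma acomp_idr f X : asrc f = X -> acomp f (aid X) = f.
Proof.
  intros <-. destruct f as [X Y f]; simpl. unfold aid.
  now rewrite <- Arrow_comp, comp_idr.
Qed.

End Arrows.

Definition aten (D : strict_moncat) (f g : arrow D) : arrow D :=
  Arrow (amor f ⊗' amor g).

Section MonoidalArrows.
Variable D : strict_moncat.
Implicit Types f g h : arrow D.

Lemma Arrow_ten (X X' Y Y' : D) (f : hom X X') (g : hom Y Y') :
  Arrow (f ⊗' g) = aten (Arrow f) (Arrow g).
Proof. reflexivity. Qed.

Lemma aid_ten (X Y : D) : aid (X ⊗ Y) = aten (aid X) (aid Y).
Proof. unfold aid, aten; simpl. now rewrite tenf_id. Qed.

Lemma atenA f g h : aten (aten f g) h = aten f (aten g h).
Proof. apply same_morE, tenfA. Qed.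

Lemma aten1f f : aten (aid one) f = f.
Proof. destruct f. apply same_morE, tenf1f. Qed.

Lemma atenf1 f : aten f (aid one) = f.
Proof. destruct f. apply same_morE, tenff1. Qed.

Lemma aten_acomp f g f' g' : atgt f = asrc g -> atgt f' = asrc g' ->
  aten (acomp g f) (acomp g' f') = acomp (aten g g') (aten f f').
Proof.
  destruct f as [X Y f], g as [Y0 Z g], f' as [X' Y' f'], g' as [Y0' Z' g']; simpl.
  intros e e'. subst Y0 Y0'.
  now rewrite <- !Arrow_comp, <- !Arrow_ten, tenf_comp, Arrow_comp.
Qed.

End MonoidalArrows.

(** * String diagrams *)

Record signature := Signature {
  wire : Type;
  box : Type;
  wire_eq : forall v w : wire, {v = w} + {v <> w};
  box_eq : forall f g : box, {f = g} + {f <> g};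
  box_dom : box -> list wire;
  box_cod : box -> list wire
}.

Section Diagrams.
Variable S : signature.
Notation word := (list (wire S)).

Inductive diagram :=
| Box (f : box S)
| Id (l : word)
| Comp (d e : diagram)
| Ten (d e : diagram).

Fixpoint dom (d : diagram) : word :=
  match d with
  | Box f => box_dom f
  | Id l => l
  | Comp _ e => dom e
  | Ten d e => dom d ++ dom e
  end.

Fixpoint cod (d : diagram) : word :=
  match d with
  | Box f => box_cod f
  | Id l => l
  | Comp d _ => cod d
  | Ten d e => cod d ++ cod e
  end.

Definition word_eqb (l m : word) : bool :=
  if list_eq_dec (@wire_eq S) l m then true else false.

Fixpoint well_typed (d : diagram) : bool :=
  match d with
  | Box _ | Id _ => true
  | Comp d e => well_typed d && well_typed e && word_eqb (cod e) (dom d)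
  | Ten d e => well_typed d && well_typed e
  end.

(* The layer [(l, f, r)] is the box [f] with identity wires [l] on its left
   and [r] on its right. *)
Definition layer : Type := word * box S * word.

Definition layer_dom (L : layer) : word := let '(l, f, r) := L in l ++ box_dom f ++ r.
Definition layer_cod (L : layer) : word := let '(l, f, r) := L in l ++ box_cod f ++ r.

Definition whisker (l r : word) (L : layer) : layer :=
  let '(l', f, r') := L in (l ++ l', f, r' ++ r).

(** The list is in order of application. In a tensor product the left factor goes first; this choice
    is harmless, as diagrams are compared up to interchange. *)
Fixpoint layers (d : diagram) : list layer :=
  match d with
  | Box f => [([], f, [])]
  | Id _ => []
  | Comp d e => layers e ++ layers d
  | Ten d e => map (whisker [] (dom e)) (layers d) ++ map (whisker (cod d) []) (layers e)
  end.

Fixpoint chain (l : word) (ds : list layer) (m : word) : Prop :=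
  match ds with
  | [] => l = m
  | L :: ds => l = layer_dom L /\ chain (layer_cod L) ds m
  end.

Fixpoint strip (p l : word) : option word :=
  match p, l with
  | [], _ => Some l
  | v :: p, w :: l => if wire_eq v w then strip p l else None
  | _ :: _, [] => None
  end.

(* The interchange law for the consecutive layers [L1] and [L2], when the box
   of [L2] lies entirely to the left or to the right of the box of [L1]. *)
Definition swap (L1 L2 : layer) : option (layer * layer) :=
  let '(l1, f1, r1) := L1 in
  let '(l2, f2, r2) := L2 in
  match strip (l2 ++ box_dom f2) l1 with
  | Some m => Some ((l2, f2, m ++ box_dom f1 ++ r1), (l2 ++ box_cod f2 ++ m, f1, r1))
  | None =>
    match strip (l1 ++ box_cod f1) l2 with
    | Some m => Some ((l1 ++ box_dom f1 ++ m, f2, r2), (l1, f1, m ++ box_cod f2 ++ r2))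
    | None => None
    end
  end.

Fixpoint pull (k : nat) (ds : list layer) : option (layer * list layer) :=
  match k, ds with
  | _, [] => None
  | O, L :: ds => Some (L, ds)
  | Datatypes.S k, L :: ds =>
    match pull k ds with
    | Some (L', ds') =>
      match swap L L' with
      | Some (M', M) => Some (M', M :: ds')
      | None => None
      end
    | None => None
    end
  end.

(** Transparent, since [interchangeable] computes with it. *)
Definition layer_eq (L M : layer) : {L = M} + {L <> M}.
Proof.
  pose proof (list_eq_dec (@wire_eq S)). pose proof (@box_eq S).
  decide equality. decide equality.
Defined.

(* Unlike [existsb], lazy in the second disjunct under [vm_compute]. *)
Fixpoint first_success (p : nat -> bool) (k n : nat) : bool :=
  match n with
  | O => false
  | Datatypes.S n => if p k then true else first_success p (Datatypes.S k) n
  end.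

(** Several boxes may yield the layer [L] when pulled to the front, so the search backtracks over
    all positions. A failed search proves nothing. *)
Fixpoint interchangeable (ds es : list layer) {struct es} : bool :=
  match es with
  | [] => match ds with [] => true | _ :: _ => false end
  | L :: es =>
    first_success (fun k =>
      match pull k ds with
      | Some (L', ds') => if layer_eq L' L then interchangeable ds' es else false
      | None => false
      end) 0 (length ds)
  end.

Definition check (d e : diagram) : bool :=
  well_typed d && well_typed e && word_eqb (dom d) (dom e) && word_eqb (cod d) (cod e)
    && interchangeable (layers d) (layers e).

(** * Interpretation of diagrams in a strict monoidal category *)

Variable D : strict_moncat.

Fixpoint word_ob (wob : wire S -> D) (l : word) : D :=
  match l with
  | [] => one
  | w :: l => wob w ⊗ word_ob wob l
  end.

Record model := Model {
  wire_ob : wire S -> D;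
  box_arrow : box S -> arrow D;
  asrc_box : forall f, asrc (box_arrow f) = word_ob wire_ob (box_dom f);
  atgt_box : forall f, atgt (box_arrow f) = word_ob wire_ob (box_cod f)
}.

Variable M : model.
Notation obj := (word_ob (wire_ob M)).

Fixpoint sem (d : diagram) : arrow D :=
  match d with
  | Box f => box_arrow M f
  | Id l => aid (obj l)
  | Comp d e => acomp (sem d) (sem e)
  | Ten d e => aten (sem d) (sem e)
  end.

Definition equiv (d e : diagram) : Prop := sem d = sem e.

#[global] Instance equiv_Equivalence : Equivalence equiv.
Proof. unfold equiv. split; congruence. Qed.

#[global] Instance Comp_Proper : Proper (equiv ==> equiv ==> equiv) Comp.
Proof. unfold equiv. intros d d' E e e' E'; simpl; congruence. Qed.

#[global] Instance Ten_Proper : Proper (equiv ==> equiv ==> equiv) Ten.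
Proof. unfold equiv. intros d d' E e e' E'; simpl; congruence. Qed.

Lemma word_ob_app (l m : word) : obj (l ++ m) = obj l ⊗ obj m.
Proof.
  induction l as [|w l IH]; simpl.
  - now rewrite ten1X.
  - now rewrite IH, tenA.
Qed.

Lemma aid_app (l m : word) : aid (obj (l ++ m)) = aten (aid (obj l)) (aid (obj m)).
Proof. now rewrite word_ob_app, aid_ten. Qed.

Lemma word_eqbP (l m : word) : word_eqb l m = true -> l = m.
Proof. unfold word_eqb. now destruct list_eq_dec. Qed.

Lemma sem_typed (d : diagram) : well_typed d = true ->
  asrc (sem d) = obj (dom d) /\ atgt (sem d) = obj (cod d).
Proof.
  induction d as [f|l|d IHd e IHe|d IHd e IHe]; simpl; intros T.
  - split; [apply asrc_box | apply atgt_box].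
  - easy.
  - apply andb_true_iff in T as [T T3]. apply andb_true_iff in T as [T1 T2].
    apply word_eqbP in T3. destruct (IHd T1), (IHe T2).
    rewrite asrc_acomp, atgt_acomp by congruence. now split.
  - apply andb_true_iff in T as [T1 T2]. destruct (IHd T1), (IHe T2).
    rewrite !word_ob_app. split; congruence.
Qed.

(** * Soundness of the decomposition into layers *)

Definition layer_sem (L : layer) : arrow D :=
  let '(l, f, r) := L in aten (aid (obj l)) (aten (box_arrow M f) (aid (obj r))).

Fixpoint layers_sem (l : word) (ds : list layer) : arrow D :=
  match ds with
  | [] => aid (obj l)
  | L :: ds => acomp (layers_sem (layer_cod L) ds) (layer_sem L)
  end.

Lemma asrc_layer (L : layer) : asrc (layer_sem L) = obj (layer_dom L).
Proof. destruct L as [[l f] r]; simpl. now rewrite !word_ob_app, asrc_box. Qed.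

Lemma atgt_layer (L : layer) : atgt (layer_sem L) = obj (layer_cod L).
Proof. destruct L as [[l f] r]; simpl. now rewrite !word_ob_app, atgt_box. Qed.

Lemma layers_sem_typed (l m : word) (ds : list layer) : chain l ds m ->
  asrc (layers_sem l ds) = obj l /\ atgt (layers_sem l ds) = obj m.
Proof.
  revert l. induction ds as [|L ds IH]; simpl; intros l.
  - now intros <-.
  - intros [-> K]. destruct (IH _ K).
    rewrite asrc_acomp, asrc_layer, atgt_acomp; [easy|].
    now rewrite atgt_layer.
Qed.

Lemma chain_app (l m n : word) (ds es : list layer) :
  chain l ds m -> chain m es n ->
  chain l (ds ++ es) n /\
  layers_sem l (ds ++ es) = acomp (layers_sem m es) (layers_sem l ds).
Proof.
  revert l. induction ds as [|L ds IH]; simpl; intros l K K'.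
  - subst m. split; [easy|]. rewrite acomp_idr; [easy|].
    now apply (layers_sem_typed K').
  - destruct K as [-> K]. destruct (IH _ K K') as [K2 E]. repeat split; [easy|].
    destruct (layers_sem_typed K), (layers_sem_typed K').
    rewrite E, acompA; rewrite ?atgt_layer; congruence.
Qed.

Lemma chain_whisker (l r l' r' : word) (ds : list layer) :
  chain l' ds r' ->
  chain (l ++ l' ++ r) (map (whisker l r) ds) (l ++ r' ++ r) /\
  layers_sem (l ++ l' ++ r) (map (whisker l r) ds)
  = aten (aid (obj l)) (aten (layers_sem l' ds) (aid (obj r))).
Proof.
  revert l'. induction ds as [|L ds IH]; simpl; intros l' K.
  - subst. split; [easy|]. now rewrite !aid_app.
  - destruct K as [-> K]. destruct (IH _ K) as [K2 E].
    destruct L as [[u f] v]; simpl in *.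
    replace ((l ++ u) ++ box_dom f ++ v ++ r)
      with (l ++ (u ++ box_dom f ++ v) ++ r) by now rewrite <- !app_assoc.
    replace ((l ++ u) ++ box_cod f ++ v ++ r)
      with (l ++ (u ++ box_cod f ++ v) ++ r) by now rewrite <- !app_assoc.
    repeat split; [easy|]. rewrite E.
    pose proof (layers_sem_typed K) as [E1 E2].
    rewrite !aid_app.
    set (X := layers_sem _ _) in *.
    (* The box is grouped with its inner wires [u] and [v], so that the outer wires [l] and [r]
       split off by the interchange law. *)
    rewrite !atenA, <- (atenA (aid (obj u))), <- (atenA (aten (aid (obj u)) _)).
    rewrite <- !aten_acomp; rewrite ?acomp_idl; rewrite ?atenA; try reflexivity;
      simpl; rewrite ?E1, ?atgt_box, ?word_ob_app, ?tenA; reflexivity.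
Qed.

Lemma layers_sound (d : diagram) : well_typed d = true ->
  chain (dom d) (layers d) (cod d) /\ sem d = layers_sem (dom d) (layers d).
Proof.
  induction d as [f|l|d IHd e IHe|d IHd e IHe]; simpl; intros T.
  - rewrite !app_nil_r, atenf1, aten1f, acomp_idl; [easy|]. apply atgt_box.
  - easy.
  - apply andb_true_iff in T as [T T3]. apply andb_true_iff in T as [T1 T2].
    apply word_eqbP in T3. destruct (IHd T1) as [K1 ->], (IHe T2) as [K2 ->].
    rewrite T3 in K2. destruct (chain_app K2 K1) as [K ->]. now split.
  - apply andb_true_iff in T as [T1 T2].
    destruct (IHd T1) as [K1 E1], (IHe T2) as [K2 E2].
    pose proof (chain_whisker [] (dom e) K1) as [W1 F1].
    pose proof (chain_whisker (cod d) [] K2) as [W2 F2].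
    rewrite !app_nil_r in W2. rewrite !app_nil_r in F2. simpl in W1, F1.
    destruct (chain_app W1 W2) as [K E]. split; [easy|].
    pose proof (layers_sem_typed K1) as [S1 S2].
    pose proof (layers_sem_typed K2) as [S3 S4].
    rewrite E, F1, F2, aten1f, atenf1.
    rewrite <- aten_acomp, acomp_idl, acomp_idr by (simpl; congruence).
    now rewrite E1, E2.
Qed.

(** * Soundness of the interchange check *)

Lemma stripP (p l m : word) : strip p l = Some m -> l = p ++ m.
Proof.
  revert l. induction p as [|v p IH]; intros [|w l]; simpl; try congruence.
  destruct wire_eq as [->|]; [|congruence]. intros E. now rewrite (IH _ E).
Qed.

(** Both sides reduce to [f] and [g] side by side, separated by the wires [m]. *)
Lemma interchange (l m r : word) (f g : box S) :
  let low := (l, f, m ++ box_cod g ++ r) in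
  let low' := (l, f, m ++ box_dom g ++ r) in
  let high := (l ++ box_cod f ++ m, g, r) in
  let high' := (l ++ box_dom f ++ m, g, r) in
  acomp (layer_sem low) (layer_sem high') = acomp (layer_sem high) (layer_sem low').
Proof.
  simpl. rewrite !aid_app, !atenA.
  rewrite <- !aten_acomp; rewrite ?acomp_idl, ?acomp_idr; try reflexivity; simpl;
    rewrite ?asrc_box, ?atgt_box; reflexivity.
Qed.

Lemma swap_sound (L1 L2 L1' L2' : layer) :
  swap L1 L2 = Some (L2', L1') -> layer_cod L1 = layer_dom L2 ->
  layer_dom L2' = layer_dom L1 /\ layer_dom L1' = layer_cod L2' /\
  layer_cod L1' = layer_cod L2 /\
  acomp (layer_sem L2) (layer_sem L1) = acomp (layer_sem L1') (layer_sem L2').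
Proof.
  destruct L1 as [[l1 f1] r1], L2 as [[l2 f2] r2]. unfold swap.
  destruct (strip (l2 ++ box_dom f2) l1) as [m|] eqn:E.
  - intros [= <- <-]. apply stripP in E. subst l1. simpl.
    (* [swap] does not inspect [r2] in this case; composability of the two layers forces it to be
       [m ++ box_cod f1 ++ r1]. *)
    rewrite <- !app_assoc. intros E. apply app_inv_head, app_inv_head in E. subst r2.
    repeat split. apply interchange.
  - clear E. destruct (strip (l1 ++ box_cod f1) l2) as [m|] eqn:E; [|congruence].
    intros [= <- <-]. apply stripP in E. subst l2. simpl.
    rewrite <- !app_assoc. intros E. apply app_inv_head, app_inv_head in E. subst r1.
    repeat split. symmetry. apply interchange.
Qed.

Lemma pull_sound (k : nat) (ds ds' : list layer) (L : layer) (l m : word) :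
  pull k ds = Some (L, ds') -> chain l ds m ->
  chain l (L :: ds') m /\ layers_sem l ds = layers_sem l (L :: ds').
Proof.
  revert ds ds' L l. induction k as [|k IH]; intros [|L0 ds] ds' L l; simpl; try congruence.
  - now intros [= -> ->].
  - destruct (pull k ds) as [[L1 ds1]|] eqn:E; [|congruence].
    destruct (swap L0 L1) as [[M1 M0]|] eqn:E'; [|congruence].
    intros [= <- <-] [-> K]. destruct (IH _ _ _ _ E K) as [[K1 K2] ->].
    destruct (swap_sound E' K1) as (F1 & F2 & F3 & F4). simpl.
    rewrite F3. repeat split; try congruence.
    pose proof (layers_sem_typed K2) as [T1 T2].
    rewrite <- !acompA; rewrite ?asrc_layer, ?atgt_layer; congruence.
Qed.

Lemma first_successP (p : nat -> bool) (k n : nat) :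
  first_success p k n = true -> exists j, p j = true.
Proof.
  revert k. induction n as [|n IH]; simpl; intros k; [easy|].
  destruct (p k) eqn:E; [now exists k | apply IH].
Qed.

Lemma interchangeable_sound (ds es : list layer) (l m : word) :
  interchangeable ds es = true -> chain l ds m -> layers_sem l ds = layers_sem l es.
Proof.
  revert ds l. induction es as [|L es IH]; intros ds l E K.
  - now destruct ds.
  - apply first_successP in E as [k E].
    destruct (pull k ds) as [[L' ds']|] eqn:P; [|easy].
    destruct (layer_eq L' L) as [->|]; [|easy].
    destruct (pull_sound P K) as [[_ K'] ->]. simpl.
    now rewrite (IH _ _ E K').
Qed.

Lemma check_sound (d e : diagram) : check d e = true -> equiv d e.
Proof.
  unfold check. rewrite !andb_true_iff. intros [[[[T T'] E] E'] K].
  apply word_eqbP in E, E'.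
  destruct (layers_sound T) as [C1 S1], (layers_sound T') as [C2 S2].
  unfold equiv. rewrite S1, S2, <- E. exact (interchangeable_sound K C1).
Qed.

(** Lets a whole diagram enter the naturality of the braiding, which is stated for typed
    morphisms. *)
Lemma diagram_hom (d : diagram) : well_typed d = true ->
  exists f : hom (obj (dom d)) (obj (cod d)), sem d = Arrow f.
Proof.
  intros T. destruct (sem_typed T) as [<- <-]. exists (amor (sem d)).
  now destruct (sem d).
Qed.

End Diagrams.

Declare Scope diagram_scope.
Delimit Scope diagram_scope with diagram.
Notation "g ∘ f" := (Comp g f) : diagram_scope.
Notation "f ⊗ g" := (Ten f g) : diagram_scope.

Ltac string := apply check_sound; vm_compute; reflexivity.

(* [step C L], for [L : l ≈ r], rewrites a goal [d ≈ e] to [C r ≈ e], where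
   [d] and [C l] agree up to the strict monoidal category axioms. *)
Ltac step C L :=
  let T := type of L in
  lazymatch T with
  | equiv ?M ?l ?r =>
    let Cl := eval cbv beta in (C l) in
    let Cr := eval cbv beta in (C r) in
    transitivity Cl; [string|];
    transitivity Cr;
      [repeat first [exact L | reflexivity | apply Comp_Proper | apply Ten_Proper]|]
  end.

(** * Diagrams for crossed products *)

Inductive crossed_wire := WA | WH.

(** [Bsigma'] is reserved for the convolution inverse of sigma. The braiding of H has a box only for
    a single wire; longer words are handled by [cross]. *)
Inductive crossed_box :=
  BmuA | BetaA | BmuH | BetaH | BDelta | Beps | Bnu | Bsigma | Bsigma' | Bbraid (w : crossed_wire).

(** Transparent, so that [check] can compare wires and boxes by computation. *)
Definition crossed : signature.
Proof.
  refine {| wire := crossed_wire; box := crossed_box;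
    box_dom := fun f => match f with
      | BmuA => [WA; WA] | BetaA => [] | BmuH => [WH; WH] | BetaH => []
      | BDelta => [WH] | Beps => [WH] | Bnu => [WH; WA]
      | Bsigma => [WH; WH] | Bsigma' => [WH; WH] | Bbraid w => [WH; w] end;
    box_cod := fun f => match f with
      | BmuA => [WA] | BetaA => [WA] | BmuH => [WH] | BetaH => [WH]
      | BDelta => [WH; WH] | Beps => [] | Bnu => [WA]
      | Bsigma => [WA] | Bsigma' => [WA] | Bbraid w => [w; WH] end |};
  repeat decide equality.
Defined.

Definition idI : diagram crossed := Id (S := crossed) [].
Definition idA : diagram crossed := Id (S := crossed) [WA].
Definition idH : diagram crossed := Id (S := crossed) [WH].
Definition dmuA : diagram crossed := Box (S := crossed) BmuA.
Definition detaA : diagram crossed := Box (S := crossed) BetaA.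
Definition dmu : diagram crossed := Box (S := crossed) BmuH.
Definition deta : diagram crossed := Box (S := crossed) BetaH.
Definition dDelta : diagram crossed := Box (S := crossed) BDelta.
Definition deps : diagram crossed := Box (S := crossed) Beps.
Definition dnu : diagram crossed := Box (S := crossed) Bnu.
Definition dsigma : diagram crossed := Box (S := crossed) Bsigma.
Definition dsigma' : diagram crossed := Box (S := crossed) Bsigma'.
Definition dbraid (w : crossed_wire) : diagram crossed := Box (S := crossed) (Bbraid w).
Notation id1 w := (Id (S := crossed) [w]).
Notation cA := (dbraid WA).
Notation cH := (dbraid WH).

Section CrossedDiagrams.
Local Open Scope diagram_scope.

(** The braiding of H past a word, unfolded by the hexagon in the right variable. The base case is
    an identity because of [abraid_oner]. *)
Fixpoint cross (l : list crossed_wire) : diagram crossed :=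
  match l with
  | [] => idH
  | w :: l => (id1 w ⊗ cross l) ∘ (dbraid w ⊗ Id (S := crossed) l)
  end.

Definition DeltaHH := (idH ⊗ cH ⊗ idH) ∘ (dDelta ⊗ dDelta).
Definition cnu := (dnu ⊗ idH) ∘ (idH ⊗ cA) ∘ (dDelta ⊗ idA).
Definition shat := (dsigma ⊗ dmu) ∘ DeltaHH.
Definition msigma := (dmuA ⊗ idH) ∘ (dmuA ⊗ shat) ∘ (idA ⊗ cnu ⊗ idH).

End CrossedDiagrams.

(** * The functor and the braiding on bundled arrows *)

Section BraidArrows.
Variables (C D : strict_moncat) (F : strict_monfunctor C D) (c : left_braiding F).

Definition abraid (X : C) (V : D) : arrow D := Arrow (c X V).

(** Allows the functor to be applied to equations of C that hold only up to strictness. *)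
Lemma Arrow_fmap (X Y X' Y' : C) (f : hom X Y) (g : hom X' Y') :
  Arrow f = Arrow g -> Arrow (fmap F f) = Arrow (fmap F g).
Proof.
  intros E. exact (f_equal (fun a => Arrow (fmap F (amor a))) E).
Qed.

Lemma Arrow_fmap_id (X : C) : Arrow (fmap F (idm X)) = aid (F X).
Proof. now rewrite fmap_id. Qed.

Lemma Arrow_fmap_comp (X Y Z : C) (g : hom Y Z) (f : hom X Y) :
  Arrow (fmap F (g ∘ f)) = acomp (Arrow (fmap F g)) (Arrow (fmap F f)).
Proof. now rewrite fmap_comp, Arrow_comp. Qed.

Lemma Arrow_fmap_ten (X X' Y Y' : C) (f : hom X X') (g : hom Y Y') :
  Arrow (fmap F (f ⊗' g)) = aten (Arrow (fmap F f)) (Arrow (fmap F g)).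
Proof. rewrite <- Arrow_ten. apply same_morE, fmap_ten. Qed.

Lemma abraid_nat (X Y : C) (V W : D) (f : hom X Y) (g : hom V W) :
  acomp (abraid Y W) (aten (Arrow (fmap F f)) (Arrow g))
  = acomp (aten (Arrow g) (Arrow (fmap F f))) (abraid X V).
Proof. unfold abraid. now rewrite <- !Arrow_ten, <- !Arrow_comp, braid_nat. Qed.

Lemma abraid_tenl (X Y : C) (V : D) :
  abraid (X ⊗ Y) V
  = acomp (aten (abraid X V) (aid (F Y))) (aten (aid (F X)) (abraid Y V)).
Proof.
  pose proof (braid_tenl c X Y V) as E. apply same_morE in E.
  now rewrite Arrow_scomp, !Arrow_ten in E.
Qed.

Lemma abraid_tenr (X : C) (V W : D) :
  abraid X (V ⊗ W)
  = acomp (aten (aid V) (abraid X W)) (aten (abraid X V) (aid W)).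
Proof.
  pose proof (braid_tenr c X V W) as E. apply same_morE in E.
  now rewrite Arrow_scomp, !Arrow_ten in E.
Qed.

(** Cancelling one factor of an invertible idempotent leaves the identity. Equality of X and Y is
    kept propositional, as source and target of a braiding with the unit agree only by
    strictness. *)
Lemma idempotent_iso_id (B : category) (X Y : B) (f : hom X Y) :
  X = Y -> is_iso f -> Arrow f = acomp (Arrow f) (Arrow f) -> Arrow f = aid X.
Proof.
  intros E [g [G1 G2]]. subst Y. rewrite <- Arrow_comp. intros I.
  apply Arrow_inj in I. unfold aid.
  now rewrite <- (comp_idl f), <- G1, <- compA, <- I.
Qed.

(** Since 1 is 1 ⊗ 1, the hexagon says that the braiding with 1 is idempotent, and it is
    invertible. *)
Lemma abraid_onel (V : D) : abraid one V = aid V.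
Proof.
  transitivity (aid (F one ⊗ V)); [|now rewrite fob_one, ten1X].
  apply idempotent_iso_id; [now rewrite fob_one, ten1X, tenX1 | apply braid_iso |].
  change (Arrow (c one V)) with (abraid one V).
  rewrite <- (ten1X (one : C)) at 1. rewrite abraid_tenl, fob_one.
  now rewrite aten1f, atenf1.
Qed.

Lemma abraid_oner (X : C) : abraid X one = aid (F X).
Proof.
  transitivity (aid (F X ⊗ one)); [|now rewrite tenX1].
  apply idempotent_iso_id; [now rewrite ten1X, tenX1 | apply braid_iso |].
  change (Arrow (c X one)) with (abraid X one).
  rewrite <- (ten1X (one : D)) at 1. rewrite abraid_tenr.
  now rewrite aten1f, atenf1.
Qed.

End BraidArrows.

Lemma equiv_sym (S : signature) (D : strict_moncat) (M : model S D) (d e : diagram S) :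
  equiv M d e -> equiv M e d.
Proof. now symmetry. Qed.

Lemma Arrow_idm (B : category) (X : B) : Arrow (idm X) = aid X.
Proof. reflexivity. Qed.

(* Pushing [Arrow] through all operations erases the casts, after which an axiom of the structure
   and its diagram form coincide. *)
#[local] Hint Rewrite Arrow_cast Arrow_scomp Arrow_comp Arrow_ten Arrow_idm
  Arrow_fmap_comp Arrow_fmap_ten Arrow_fmap_id aid_ten atenf1 : arrows.

Ltac unfold_sem := unfold equiv; simpl; rewrite ?tenX1.

Ltac from_eq E :=
  let K := fresh in
  pose proof E as K; first [apply same_morE in K | apply (f_equal Arrow) in K];
  unfold epsH, deltaH in K; simpl in K; autorewrite with arrows in K; unfold_sem; exact K.

Ltac from_eq_fmap F E :=
  let K := fresh in
  pose proof E as K; apply same_morE, (Arrow_fmap F) in K;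
  autorewrite with arrows in K; unfold_sem; exact K.

(** * The model given by H, A and sigma *)

Section CrossedProduct.
Variables (C D : strict_moncat) (F : strict_monfunctor C D) (c : left_braiding F).
Variables (H : bialgebra c) (A : measuring H) (sigma sigma' : hom (F H ⊗ F H) A).

(** The structure maps of H are interpreted by their bare images under F, because bundled arrows do
    not see the casts in [muH] and [deltaH]. *)
Definition crossed_model : model crossed D.
Proof.
  refine (@Model crossed D
    (fun w : crossed_wire => match w with WA => alg_ob A | WH => F H end)
    (fun f : crossed_box => match f with
      | BmuA => Arrow (mul (alg_str A))
      | BetaA => Arrow (eta (alg_str A))
      | BmuH => Arrow (fmap F (mul (bialg_alg H)))
      | BetaH => Arrow (fmap F (eta (bialg_alg H)))
      | BDelta => Arrow (fmap F (delta (bialg_coalg H)))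
      | Beps => Arrow (fmap F (eps (bialg_coalg H)))
      | Bnu => Arrow (nu A)
      | Bsigma => Arrow sigma
      | Bsigma' => Arrow sigma'
      | Bbraid w => abraid c H match w with WA => alg_ob A | WH => F H end
      end) _ _);
  intros []; simpl; now rewrite ?fob_ten, ?fob_one, ?tenX1.
Defined.

Local Notation M := crossed_model.
Local Notation "d ≈ e" := (equiv M d%diagram e%diagram) (at level 70).
Local Open Scope diagram_scope.

(** * Axioms of algebras, bialgebra and measuring as diagram equations *)

Lemma muA_assoc : dmuA ∘ (dmuA ⊗ idA) ≈ dmuA ∘ (idA ⊗ dmuA).
Proof. from_eq (mul_assoc (algP A)). Qed.

Lemma muA_unitl : dmuA ∘ (detaA ⊗ idA) ≈ idA.
Proof. from_eq (mul_unitl (algP A)). Qed.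

Lemma muA_unitr : dmuA ∘ (idA ⊗ detaA) ≈ idA.
Proof. from_eq (mul_unitr (algP A)). Qed.

Lemma mu_assoc : dmu ∘ (dmu ⊗ idH) ≈ dmu ∘ (idH ⊗ dmu).
Proof. from_eq_fmap F (mul_assoc (bialg_algP H)). Qed.

Lemma mu_unitl : dmu ∘ (deta ⊗ idH) ≈ idH.
Proof. from_eq_fmap F (mul_unitl (bialg_algP H)). Qed.

Lemma mu_unitr : dmu ∘ (idH ⊗ deta) ≈ idH.
Proof. from_eq_fmap F (mul_unitr (bialg_algP H)). Qed.

Lemma Delta_coassoc : (dDelta ⊗ idH) ∘ dDelta ≈ (idH ⊗ dDelta) ∘ dDelta.
Proof. from_eq_fmap F (delta_coassoc (bialg_coalgP H)). Qed.

Lemma Delta_counitl : (deps ⊗ idH) ∘ dDelta ≈ idH.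
Proof. from_eq_fmap F (delta_counitl (bialg_coalgP H)). Qed.

Lemma Delta_counitr : (idH ⊗ deps) ∘ dDelta ≈ idH.
Proof. from_eq_fmap F (delta_counitr (bialg_coalgP H)). Qed.

Lemma Delta_mu : dDelta ∘ dmu ≈ (dmu ⊗ dmu) ∘ DeltaHH.
Proof. from_eq (coalg_mor_delta (bialg_mulP H)). Qed.

Lemma eps_mu : deps ∘ dmu ≈ deps ⊗ deps.
Proof. from_eq (coalg_mor_eps (bialg_mulP H)). Qed.

Lemma Delta_eta : dDelta ∘ deta ≈ deta ⊗ deta.
Proof.
  pose proof (coalg_mor_delta (bialg_etaP H)) as K. apply (f_equal Arrow) in K.
  simpl in K. autorewrite with arrows in K.
  (* The unit coalgebra has an identity, up to a cast, as comultiplication, and its image under F is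
     again an identity. *)
  unfold_sem. rewrite K, (Arrow_fmap F (Arrow_cast _ _ (idm one))), Arrow_fmap_id.
  apply acomp_idr. simpl. now rewrite fob_one, ten1X.
Qed.

Lemma eps_eta : deps ∘ deta ≈ idI.
Proof.
  pose proof (coalg_mor_eps (bialg_etaP H)) as K. apply (f_equal Arrow) in K.
  simpl in K. autorewrite with arrows in K. unfold_sem. now rewrite K, fob_one.
Qed.

Lemma nu_unit_H : dnu ∘ (deta ⊗ idA) ≈ idA.
Proof. from_eq (nu_etaH A). Qed.

Lemma nu_unit_A : dnu ∘ (idH ⊗ detaA) ≈ detaA ∘ deps.
Proof. from_eq (nu_eta A). Qed.

Lemma nu_mult : dnu ∘ (idH ⊗ dmuA)
  ≈ dmuA ∘ (dnu ⊗ dnu) ∘ (idH ⊗ cA ⊗ idA) ∘ (dDelta ⊗ idA ⊗ idA).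
Proof. from_eq (nu_mul A). Qed.

(** * Sliding diagrams through the braiding *)

Lemma sem_cross (l : list crossed_wire) :
  sem M (cross l) = abraid c H (word_ob (wire_ob M) l).
Proof.
  induction l as [|w l IH]; simpl.
  - now rewrite tenX1, abraid_oner.
  - now rewrite IH, abraid_tenr, tenX1.
Qed.

(** Naturality in the second variable for composite diagrams; for a concrete [d] the premise holds
    by computation. *)
Lemma cross_nat (d : diagram crossed) : well_typed d = true ->
  cross (cod d) ∘ (idH ⊗ d) ≈ (d ⊗ idH) ∘ cross (dom d).
Proof.
  intros T. destruct (diagram_hom M T) as [f E]. unfold equiv; simpl.
  rewrite !sem_cross, E, tenX1, <- Arrow_fmap_id. apply abraid_nat.
Qed.

Lemma abraid_natl (X Y : C) (V : D) (f : hom X Y) :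
  acomp (abraid c Y V) (aten (Arrow (fmap F f)) (aid V))
  = acomp (aten (aid V) (Arrow (fmap F f))) (abraid c X V).
Proof. apply abraid_nat. Qed.

(** Naturality in the first variable, combined with the hexagon for H ⊗ H. *)
Lemma braid_mu (w : crossed_wire) :
  dbraid w ∘ (dmu ⊗ id1 w) ≈ (id1 w ⊗ dmu) ∘ ((dbraid w ⊗ idH) ∘ (idH ⊗ dbraid w)).
Proof. unfold_sem. rewrite <- abraid_tenl. apply abraid_natl. Qed.

Lemma braid_Delta (w : crossed_wire) :
  (id1 w ⊗ dDelta) ∘ dbraid w ≈ (dbraid w ⊗ idH) ∘ (idH ⊗ dbraid w) ∘ (dDelta ⊗ id1 w).
Proof. unfold_sem. rewrite <- abraid_tenl. symmetry. apply abraid_natl. Qed.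

Lemma braid_eta (w : crossed_wire) : dbraid w ∘ (deta ⊗ id1 w) ≈ id1 w ⊗ deta.
Proof.
  unfold_sem. rewrite abraid_natl, abraid_onel. apply acomp_idr. simpl.
  now rewrite fob_one, tenX1.
Qed.

Lemma braid_eps (w : crossed_wire) : (id1 w ⊗ deps) ∘ dbraid w ≈ deps ⊗ id1 w.
Proof.
  unfold_sem. rewrite <- abraid_natl, abraid_onel. apply acomp_idl. simpl.
  now rewrite fob_one, ten1X.
Qed.

(** * Compatibility of s^ and c^nu with the comultiplication *)

(** Sliding Delta through the crossing reduces the claim to coassociativity in each of the two
    factors. *)
Lemma DeltaHH_coassoc : (DeltaHH ⊗ idH ⊗ idH) ∘ DeltaHH ≈ (idH ⊗ idH ⊗ DeltaHH) ∘ DeltaHH.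
Proof.
  step (fun x => (idH ⊗ cH ⊗ idH ⊗ idH ⊗ idH) ∘ (dDelta ⊗ x ⊗ idH) ∘ (dDelta ⊗ dDelta))
    (equiv_sym (cross_nat (d := dDelta) eq_refl)).
  step (fun x => (idH ⊗ cH ⊗ idH ⊗ idH ⊗ idH) ∘ (idH ⊗ idH ⊗ cross [WH; WH] ⊗ idH)
    ∘ (x ⊗ ((dDelta ⊗ idH) ∘ dDelta))) Delta_coassoc.
  step (fun x => (idH ⊗ cH ⊗ idH ⊗ idH ⊗ idH) ∘ (idH ⊗ idH ⊗ cross [WH; WH] ⊗ idH)
    ∘ (((idH ⊗ dDelta) ∘ dDelta) ⊗ x)) Delta_coassoc.
  step (fun x => (idH ⊗ idH ⊗ idH ⊗ cH ⊗ idH) ∘ (idH ⊗ x ⊗ dDelta) ∘ (dDelta ⊗ dDelta))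
    (equiv_sym (braid_Delta WH)).
  string.
Qed.

(** Says that s^ is right H-colinear, H ⊗ H coacting through its comultiplication followed by mu. *)
Lemma shat_comodule : (idA ⊗ dDelta) ∘ shat ≈ (shat ⊗ dmu) ∘ DeltaHH.
Proof.
  step (fun x => (dsigma ⊗ x) ∘ DeltaHH) Delta_mu.
  step (fun x => (dsigma ⊗ dmu ⊗ dmu) ∘ x) (equiv_sym DeltaHH_coassoc).
  string.
Qed.

Lemma cnu_comodule : (idA ⊗ dDelta) ∘ cnu ≈ (cnu ⊗ idH) ∘ (idH ⊗ cA) ∘ (dDelta ⊗ idA).
Proof.
  step (fun x => (dnu ⊗ idH ⊗ idH) ∘ (idH ⊗ x) ∘ (dDelta ⊗ idA)) (braid_Delta WA).
  step (fun x => (dnu ⊗ idH ⊗ idH) ∘ (idH ⊗ cA ⊗ idH) ∘ (idH ⊗ idH ⊗ cA) ∘ (x ⊗ idA))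
    (equiv_sym Delta_coassoc).
  string.
Qed.

(** Colinearity splits the composite, over the comultiplication of H ⊗ H ⊗ H, into one side of (i)
    and a triple product in H. [shat_shat_r] does the same for the other side over the same
    comultiplication, so (i) and associativity of mu suffice to compare them. *)
Lemma shat_shat_l :
  (dmuA ⊗ idH) ∘ (idA ⊗ shat) ∘ (shat ⊗ idH)
  ≈ ((dmuA ∘ (idA ⊗ dsigma) ∘ (shat ⊗ idH)) ⊗ (dmu ∘ (dmu ⊗ idH)))
    ∘ (idH ⊗ idH ⊗ ((cH ⊗ idH) ∘ (idH ⊗ cH)) ⊗ idH) ∘ (DeltaHH ⊗ dDelta).
Proof.
  step (fun x => (dmuA ⊗ idH) ∘ (idA ⊗ dsigma ⊗ dmu) ∘ (idA ⊗ idH ⊗ cH ⊗ idH) ∘ (x ⊗ dDelta))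
    shat_comodule.
  step (fun x => (dmuA ⊗ dmu) ∘ (idA ⊗ dsigma ⊗ idH ⊗ idH) ∘ (idA ⊗ idH ⊗ x ⊗ idH)
    ∘ (shat ⊗ idH ⊗ idH ⊗ dDelta) ∘ (DeltaHH ⊗ idH)) (braid_mu WH).
  string.
Qed.

Lemma shat_shat_r :
  (dmuA ⊗ idH) ∘ (idA ⊗ shat) ∘ (cnu ⊗ idH) ∘ (idH ⊗ shat)
  ≈ ((dmuA ∘ (idA ⊗ dsigma) ∘ (cnu ⊗ idH) ∘ (idH ⊗ shat)) ⊗ (dmu ∘ (idH ⊗ dmu)))
    ∘ (idH ⊗ idH ⊗ ((cH ⊗ idH) ∘ (idH ⊗ cH)) ⊗ idH) ∘ (DeltaHH ⊗ dDelta).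
Proof.
  step (fun x => (dmuA ⊗ dmu) ∘ (idA ⊗ dsigma ⊗ idH ⊗ idH) ∘ (idA ⊗ idH ⊗ cH ⊗ idH)
    ∘ (x ⊗ dDelta) ∘ (idH ⊗ shat)) cnu_comodule.
  step (fun x => (dmuA ⊗ dmu) ∘ (idA ⊗ dsigma ⊗ idH ⊗ idH) ∘ (idA ⊗ idH ⊗ cH ⊗ idH)
    ∘ (cnu ⊗ idH ⊗ idH ⊗ idH) ∘ (idH ⊗ cA ⊗ idH ⊗ idH) ∘ (dDelta ⊗ x)) shat_comodule.
  step (fun x => (dmuA ⊗ dmu) ∘ (idA ⊗ dsigma ⊗ idH ⊗ idH) ∘ (cnu ⊗ idH ⊗ idH ⊗ idH)
    ∘ (idH ⊗ x ⊗ dmu) ∘ (dDelta ⊗ DeltaHH)) (cross_nat (d := shat) eq_refl).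
  string.
Qed.

(** The analogous splitting for the two sides of (ii); here the H-output is a single product that
    has been braided past the wire A. *)
Lemma shat_cnu_l :
  (dmuA ⊗ idH) ∘ (idA ⊗ cnu) ∘ (shat ⊗ idA)
  ≈ ((dmuA ∘ (idA ⊗ dnu) ∘ (shat ⊗ idA)) ⊗ dmu)
    ∘ (idH ⊗ idH ⊗ ((cA ⊗ idH) ∘ (idH ⊗ cA))) ∘ (DeltaHH ⊗ idA).
Proof.
  step (fun x => (dmuA ⊗ idH) ∘ (idA ⊗ dnu ⊗ idH) ∘ (idA ⊗ idH ⊗ cA) ∘ (x ⊗ idA))
    shat_comodule.
  step (fun x => (dmuA ⊗ idH) ∘ (idA ⊗ dnu ⊗ idH) ∘ (idA ⊗ idH ⊗ x)
    ∘ (shat ⊗ idH ⊗ idH ⊗ idA) ∘ (DeltaHH ⊗ idA)) (braid_mu WA).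
  string.
Qed.

Lemma shat_cnu_r :
  (dmuA ⊗ idH) ∘ (idA ⊗ shat) ∘ (cnu ⊗ idH) ∘ (idH ⊗ cnu)
  ≈ ((dmuA ∘ (idA ⊗ dsigma) ∘ (cnu ⊗ idH) ∘ (idH ⊗ cnu)) ⊗ dmu)
    ∘ (idH ⊗ idH ⊗ ((cA ⊗ idH) ∘ (idH ⊗ cA))) ∘ (DeltaHH ⊗ idA).
Proof.
  step (fun x => (dmuA ⊗ dmu) ∘ (idA ⊗ dsigma ⊗ idH ⊗ idH) ∘ (idA ⊗ idH ⊗ cH ⊗ idH)
    ∘ (x ⊗ dDelta) ∘ (idH ⊗ cnu)) cnu_comodule.
  step (fun x => (dmuA ⊗ dmu) ∘ (idA ⊗ dsigma ⊗ idH ⊗ idH) ∘ (idA ⊗ idH ⊗ cH ⊗ idH)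
    ∘ (cnu ⊗ idH ⊗ idH ⊗ idH) ∘ (idH ⊗ cA ⊗ idH ⊗ idH) ∘ (dDelta ⊗ x)) cnu_comodule.
  step (fun x => (dmuA ⊗ dmu) ∘ (idA ⊗ dsigma ⊗ idH ⊗ idH) ∘ (cnu ⊗ idH ⊗ idH ⊗ idH)
    ∘ (idH ⊗ x ⊗ idH) ∘ (idH ⊗ idH ⊗ idH ⊗ cA) ∘ (dDelta ⊗ dDelta ⊗ idA))
    (cross_nat (d := cnu) eq_refl).
  string.
Qed.

(** The measuring axiom spreads h over both factors; coassociativity and naturality of c then
    regroup its three copies. *)
Lemma cnu_mul : cnu ∘ (idH ⊗ dmuA) ≈ (dmuA ⊗ idH) ∘ (idA ⊗ cnu) ∘ (cnu ⊗ idA).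
Proof.
  step (fun x => (dnu ⊗ idH) ∘ (idH ⊗ x) ∘ (dDelta ⊗ idA ⊗ idA))
    (cross_nat (d := dmuA) eq_refl).
  step (fun x => (x ⊗ idH) ∘ (idH ⊗ cross [WA; WA]) ∘ (dDelta ⊗ idA ⊗ idA)) nu_mult.
  step (fun x => (dmuA ⊗ idH) ∘ (dnu ⊗ dnu ⊗ idH) ∘ (idH ⊗ cA ⊗ idA ⊗ idH)
    ∘ (idH ⊗ idH ⊗ cross [WA; WA]) ∘ (x ⊗ idA ⊗ idA)) Delta_coassoc.
  step (fun x => (dmuA ⊗ idH) ∘ (idA ⊗ dnu ⊗ idH) ∘ (idA ⊗ idH ⊗ cA)
    ∘ (dnu ⊗ idH ⊗ idH ⊗ idA) ∘ (idH ⊗ x ⊗ idA) ∘ (dDelta ⊗ idA ⊗ idA))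
    (equiv_sym (braid_Delta WA)).
  string.
Qed.

(** * Units and counits *)

Lemma cnu_unit_H : cnu ∘ (deta ⊗ idA) ≈ idA ⊗ deta.
Proof.
  step (fun x => (dnu ⊗ idH) ∘ (idH ⊗ cA) ∘ (x ⊗ idA)) Delta_eta.
  step (fun x => (dnu ⊗ idH) ∘ (deta ⊗ x)) (braid_eta WA).
  step (fun x => x ⊗ deta) nu_unit_H.
  string.
Qed.

Lemma cnu_unit_A : cnu ∘ (idH ⊗ detaA) ≈ detaA ⊗ idH.
Proof.
  step (fun x => (dnu ⊗ idH) ∘ (idH ⊗ x) ∘ dDelta) (cross_nat (d := detaA) eq_refl).
  step (fun x => (x ⊗ idH) ∘ dDelta) nu_unit_A.
  step (fun x => detaA ⊗ x) Delta_counitl.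
  string.
Qed.

(** Makes convolution on H ⊗ H restrict along h ↦ h ⊗ 1 to convolution on H. *)
Lemma DeltaHH_eta_r : DeltaHH ∘ (idH ⊗ deta) ≈ (idH ⊗ deta ⊗ idH ⊗ deta) ∘ dDelta.
Proof.
  step (fun x => (idH ⊗ cH ⊗ idH) ∘ (dDelta ⊗ x)) Delta_eta.
  step (fun x => (idH ⊗ x ⊗ deta) ∘ dDelta) (cross_nat (d := deta) eq_refl).
  string.
Qed.

Lemma DeltaHH_eta_l : DeltaHH ∘ (deta ⊗ idH) ≈ (deta ⊗ idH ⊗ deta ⊗ idH) ∘ dDelta.
Proof.
  step (fun x => (idH ⊗ cH ⊗ idH) ∘ (x ⊗ dDelta)) Delta_eta.
  step (fun x => (deta ⊗ x ⊗ idH) ∘ dDelta) (braid_eta WH).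
  string.
Qed.

Lemma shat_eta_r : shat ∘ (idH ⊗ deta) ≈ ((dsigma ∘ (idH ⊗ deta)) ⊗ idH) ∘ dDelta.
Proof.
  step (fun x => (dsigma ⊗ dmu) ∘ x) DeltaHH_eta_r.
  step (fun x => ((dsigma ∘ (idH ⊗ deta)) ⊗ x) ∘ dDelta) mu_unitr.
  string.
Qed.

Lemma shat_eta_l : shat ∘ (deta ⊗ idH) ≈ ((dsigma ∘ (deta ⊗ idH)) ⊗ idH) ∘ dDelta.
Proof.
  step (fun x => (dsigma ⊗ dmu) ∘ x) DeltaHH_eta_l.
  step (fun x => ((dsigma ∘ (deta ⊗ idH)) ⊗ x) ∘ dDelta) mu_unitl.
  string.
Qed.

Lemma DeltaHH_counit_r : (idH ⊗ idH ⊗ deps ⊗ deps) ∘ DeltaHH ≈ idH ⊗ idH.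
Proof.
  step (fun x => (idH ⊗ x ⊗ deps) ∘ (dDelta ⊗ dDelta)) (braid_eps WH).
  step (fun x => x ⊗ ((idH ⊗ deps) ∘ dDelta)) Delta_counitr.
  step (fun x => idH ⊗ x) Delta_counitr.
  string.
Qed.

(** With [eps_cnu], the way back from the lifted equations to (i) and (ii). *)
Lemma eps_shat : (idA ⊗ deps) ∘ shat ≈ dsigma.
Proof.
  step (fun x => (dsigma ⊗ x) ∘ DeltaHH) eps_mu.
  step (fun x => dsigma ∘ x) DeltaHH_counit_r.
  string.
Qed.

Lemma eps_cnu : (idA ⊗ deps) ∘ cnu ≈ dnu.
Proof.
  step (fun x => dnu ∘ (idH ⊗ x) ∘ (dDelta ⊗ idA)) (braid_eps WA).
  step (fun x => dnu ∘ (x ⊗ idA)) Delta_counitr.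
  string.
Qed.

(** The special products (ah)(1k), (1h)(1k) and (1h)(bk), treated here and in the next two lemmas,
    link mu_sigma to s^ and c^nu. *)
Lemma msigma_unit_A :
  msigma ∘ (idA ⊗ idH ⊗ detaA ⊗ idH) ≈ (dmuA ⊗ idH) ∘ (idA ⊗ shat).
Proof.
  step (fun x => (dmuA ⊗ idH) ∘ (dmuA ⊗ shat) ∘ (idA ⊗ x ⊗ idH)) cnu_unit_A.
  step (fun x => (dmuA ⊗ idH) ∘ (x ⊗ shat)) muA_unitr.
  string.
Qed.

Lemma msigma_unit_AA : msigma ∘ (detaA ⊗ idH ⊗ detaA ⊗ idH) ≈ shat.
Proof.
  step (fun x => x ∘ (detaA ⊗ idH ⊗ idH)) msigma_unit_A.
  step (fun x => (x ⊗ idH) ∘ shat) muA_unitl.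
  string.
Qed.

Lemma msigma_unit_l :
  msigma ∘ (detaA ⊗ idH ⊗ idA ⊗ idH) ≈ (dmuA ⊗ idH) ∘ (idA ⊗ shat) ∘ (cnu ⊗ idH).
Proof.
  step (fun x => (dmuA ⊗ idH) ∘ (x ⊗ shat) ∘ (cnu ⊗ idH)) muA_unitl.
  string.
Qed.

(** * The given morphisms and their diagrams *)

Lemma Arrow_sigma_hat : Arrow (sigma_hat sigma) = sem M shat.
Proof.
  unfold sigma_hat, coalgHH, muH, shat, DeltaHH. simpl. autorewrite with arrows.
  now rewrite ?tenX1.
Qed.

Lemma Arrow_braid_nu : Arrow (braid_nu A) = sem M cnu.
Proof.
  unfold braid_nu, deltaH, cnu. simpl. autorewrite with arrows.
  now rewrite ?tenX1.
Qed.

Lemma Arrow_mu_sigma : Arrow (mu_sigma sigma) = sem M msigma.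
Proof.
  unfold mu_sigma. autorewrite with arrows.
  rewrite Arrow_sigma_hat, Arrow_braid_nu. unfold msigma. simpl. now rewrite ?tenX1.
Qed.

Lemma Arrow_eta_sigma : Arrow (eta_sigma A) = sem M (detaA ⊗ deta).
Proof. unfold eta_sigma, etaH. simpl. now autorewrite with arrows. Qed.

(** * From a cocycle to an associative unital multiplication *)

Section CocycleToAlgebra.

Hypothesis conv_l : dmuA ∘ (dsigma' ⊗ dsigma) ∘ DeltaHH ≈ detaA ∘ (deps ⊗ deps).
Hypothesis cocycle_i :
  dmuA ∘ (idA ⊗ dsigma) ∘ (shat ⊗ idH)
  ≈ dmuA ∘ (idA ⊗ dsigma) ∘ (cnu ⊗ idH) ∘ (idH ⊗ shat).
Hypothesis cocycle_ii :
  dmuA ∘ (idA ⊗ dnu) ∘ (shat ⊗ idA)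
  ≈ dmuA ∘ (idA ⊗ dsigma) ∘ (cnu ⊗ idH) ∘ (idH ⊗ cnu).
Hypothesis cocycle_iii : dsigma ∘ (deta ⊗ deta) ≈ detaA.

Lemma shat_cocycle :
  (dmuA ⊗ idH) ∘ (idA ⊗ shat) ∘ (shat ⊗ idH)
  ≈ (dmuA ⊗ idH) ∘ (idA ⊗ shat) ∘ (cnu ⊗ idH) ∘ (idH ⊗ shat).
Proof.
  rewrite shat_shat_l, shat_shat_r, cocycle_i, mu_assoc. reflexivity.
Qed.

Lemma shat_twisted_module :
  (dmuA ⊗ idH) ∘ (idA ⊗ cnu) ∘ (shat ⊗ idA)
  ≈ (dmuA ⊗ idH) ∘ (idA ⊗ shat) ∘ (cnu ⊗ idH) ∘ (idH ⊗ cnu).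
Proof.
  rewrite shat_cnu_l, shat_cnu_r, cocycle_ii. reflexivity.
Qed.

Lemma shat_eta_eta : shat ∘ (deta ⊗ deta) ≈ detaA ⊗ deta.
Proof.
  step (fun x => x ∘ deta) shat_eta_r.
  step (fun x => ((dsigma ∘ (idH ⊗ deta)) ⊗ idH) ∘ x) Delta_eta.
  step (fun x => x ⊗ deta) cocycle_iii.
  string.
Qed.

(** At (h,1,1) the left side of (i) is the convolution square of sigma(-,1). On the right, s^(1,1)
    is trivial by (iii) and c^nu moves the unit of A past h, which leaves sigma(h,1). *)
Lemma sigma_eta_r_idempotent :
  dmuA ∘ ((dsigma ∘ (idH ⊗ deta)) ⊗ (dsigma ∘ (idH ⊗ deta))) ∘ dDelta
  ≈ dsigma ∘ (idH ⊗ deta).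
Proof.
  step (fun x => dmuA ∘ (idA ⊗ dsigma) ∘ (x ⊗ deta)) (equiv_sym shat_eta_r).
  step (fun x => x ∘ (idH ⊗ deta ⊗ deta)) cocycle_i.
  step (fun x => dmuA ∘ (idA ⊗ dsigma) ∘ (cnu ⊗ idH) ∘ (idH ⊗ x)) shat_eta_eta.
  step (fun x => dmuA ∘ (idA ⊗ dsigma) ∘ (x ⊗ deta)) cnu_unit_A.
  step (fun x => x ∘ dsigma ∘ (idH ⊗ deta)) muA_unitl.
  string.
Qed.

(** At (1,1,h) the roles are exchanged: the right side of (i) is the square, and (iii) collapses the
    left side. *)
Lemma sigma_eta_l_idempotent :
  dmuA ∘ ((dsigma ∘ (deta ⊗ idH)) ⊗ (dsigma ∘ (deta ⊗ idH))) ∘ dDelta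
  ≈ dsigma ∘ (deta ⊗ idH).
Proof.
  step (fun x => dmuA ∘ (idA ⊗ (dsigma ∘ (deta ⊗ idH))) ∘ x) (equiv_sym shat_eta_l).
  step (fun x => dmuA ∘ (idA ⊗ dsigma) ∘ (x ⊗ idH) ∘ shat ∘ (deta ⊗ idH)) (equiv_sym cnu_unit_H).
  step (fun x => x ∘ (deta ⊗ deta ⊗ idH)) (equiv_sym cocycle_i).
  step (fun x => dmuA ∘ (idA ⊗ dsigma) ∘ (x ⊗ idH)) shat_eta_eta.
  step (fun x => x ∘ dsigma ∘ (deta ⊗ idH)) muA_unitl.
  string.
Qed.

Lemma conv_eta_r :
  dmuA ∘ ((dsigma' ∘ (idH ⊗ deta)) ⊗ (dsigma ∘ (idH ⊗ deta))) ∘ dDelta ≈ detaA ∘ deps.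
Proof.
  step (fun x => dmuA ∘ (dsigma' ⊗ dsigma) ∘ x) (equiv_sym DeltaHH_eta_r).
  step (fun x => x ∘ (idH ⊗ deta)) conv_l.
  step (fun x => detaA ∘ (deps ⊗ x)) eps_eta.
  string.
Qed.

Lemma conv_eta_l :
  dmuA ∘ ((dsigma' ∘ (deta ⊗ idH)) ⊗ (dsigma ∘ (deta ⊗ idH))) ∘ dDelta ≈ detaA ∘ deps.
Proof.
  step (fun x => dmuA ∘ (dsigma' ⊗ dsigma) ∘ x) (equiv_sym DeltaHH_eta_l).
  step (fun x => x ∘ (deta ⊗ idH)) conv_l.
  step (fun x => detaA ∘ (x ⊗ deps)) eps_eta.
  string.
Qed.

(** With f*f = f and g*f = 1 in the convolution algebra, f = (g*f)*f = g*(f*f) = g*f = 1. *)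
Lemma sigma_eta_r : dsigma ∘ (idH ⊗ deta) ≈ detaA ∘ deps.
Proof.
  set (f := dsigma ∘ (idH ⊗ deta)). set (g := dsigma' ∘ (idH ⊗ deta)).
  step (fun x => x ∘ f) (equiv_sym muA_unitl).
  step (fun x => dmuA ∘ (detaA ⊗ (f ∘ x))) (equiv_sym Delta_counitl).
  step (fun x => dmuA ∘ (x ⊗ f) ∘ dDelta) (equiv_sym conv_eta_r).
  step (fun x => x ∘ (g ⊗ f ⊗ f) ∘ (dDelta ⊗ idH) ∘ dDelta) muA_assoc.
  step (fun x => dmuA ∘ (idA ⊗ dmuA) ∘ (g ⊗ f ⊗ f) ∘ x) Delta_coassoc.
  step (fun x => dmuA ∘ (g ⊗ x) ∘ dDelta) sigma_eta_r_idempotent.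
  exact conv_eta_r.
Qed.

Lemma sigma_eta_l : dsigma ∘ (deta ⊗ idH) ≈ detaA ∘ deps.
Proof.
  set (f := dsigma ∘ (deta ⊗ idH)). set (g := dsigma' ∘ (deta ⊗ idH)).
  step (fun x => x ∘ f) (equiv_sym muA_unitl).
  step (fun x => dmuA ∘ (detaA ⊗ (f ∘ x))) (equiv_sym Delta_counitl).
  step (fun x => dmuA ∘ (x ⊗ f) ∘ dDelta) (equiv_sym conv_eta_l).
  step (fun x => x ∘ (g ⊗ f ⊗ f) ∘ (dDelta ⊗ idH) ∘ dDelta) muA_assoc.
  step (fun x => dmuA ∘ (idA ⊗ dmuA) ∘ (g ⊗ f ⊗ f) ∘ x) Delta_coassoc.
  step (fun x => dmuA ∘ (g ⊗ x) ∘ dDelta) sigma_eta_l_idempotent.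
  exact conv_eta_l.
Qed.

Lemma msigma_unitr : msigma ∘ (idA ⊗ idH ⊗ detaA ⊗ deta) ≈ idA ⊗ idH.
Proof.
  step (fun x => x ∘ (idA ⊗ idH ⊗ deta)) msigma_unit_A.
  step (fun x => (dmuA ⊗ idH) ∘ (idA ⊗ x)) shat_eta_r.
  step (fun x => (dmuA ⊗ idH) ∘ (idA ⊗ ((x ⊗ idH) ∘ dDelta))) sigma_eta_r.
  step (fun x => ((dmuA ∘ (idA ⊗ detaA)) ⊗ idH) ∘ (idA ⊗ x)) Delta_counitl.
  step (fun x => x ⊗ idH) muA_unitr.
  string.
Qed.

Lemma msigma_unitl : msigma ∘ (detaA ⊗ deta ⊗ idA ⊗ idH) ≈ idA ⊗ idH.
Proof.
  step (fun x => x ∘ (deta ⊗ idA ⊗ idH)) msigma_unit_l.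
  step (fun x => (dmuA ⊗ idH) ∘ (idA ⊗ shat) ∘ (x ⊗ idH)) cnu_unit_H.
  step (fun x => (dmuA ⊗ idH) ∘ (idA ⊗ x)) shat_eta_l.
  step (fun x => (dmuA ⊗ idH) ∘ (idA ⊗ ((x ⊗ idH) ∘ dDelta))) sigma_eta_l.
  step (fun x => ((dmuA ∘ (idA ⊗ detaA)) ⊗ idH) ∘ (idA ⊗ x)) Delta_counitl.
  step (fun x => x ⊗ idH) muA_unitr.
  string.
Qed.

(** For (ah)(bk)(cl): in the left bracketing, the twisted module law moves c past s^(h,k), and the
    cocycle law reassociates the two s^. In the right one, [cnu_mul] moves h through the triple
    product in A. The results differ by associativity in A. *)
Lemma msigma_assoc : msigma ∘ (msigma ⊗ idA ⊗ idH) ≈ msigma ∘ (idA ⊗ idH ⊗ msigma).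
Proof.
  step (fun x => (dmuA ⊗ idH) ∘ (x ⊗ shat) ∘ (idA ⊗ idA ⊗ cnu ⊗ idH)
    ∘ (dmuA ⊗ shat ⊗ idA ⊗ idH) ∘ (idA ⊗ cnu ⊗ idH ⊗ idA ⊗ idH)) muA_assoc.
  step (fun x => (dmuA ⊗ idH) ∘ (dmuA ⊗ shat) ∘ (idA ⊗ x ⊗ idH)
    ∘ (dmuA ⊗ idH ⊗ idH ⊗ idA ⊗ idH) ∘ (idA ⊗ cnu ⊗ idH ⊗ idA ⊗ idH)) shat_twisted_module.
  step (fun x => (dmuA ⊗ idH) ∘ (x ⊗ shat) ∘ (dmuA ⊗ idA ⊗ shat ⊗ idH)
    ∘ (idA ⊗ idA ⊗ cnu ⊗ idH ⊗ idH) ∘ (idA ⊗ idA ⊗ idH ⊗ cnu ⊗ idH)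
    ∘ (idA ⊗ cnu ⊗ idH ⊗ idA ⊗ idH)) (equiv_sym muA_assoc).
  step (fun x => (x ⊗ idH) ∘ (dmuA ⊗ idA ⊗ shat) ∘ (dmuA ⊗ idA ⊗ shat ⊗ idH)
    ∘ (idA ⊗ idA ⊗ cnu ⊗ idH ⊗ idH) ∘ (idA ⊗ idA ⊗ idH ⊗ cnu ⊗ idH)
    ∘ (idA ⊗ cnu ⊗ idH ⊗ idA ⊗ idH)) muA_assoc.
  step (fun x => (dmuA ⊗ idH) ∘ (dmuA ⊗ x) ∘ (dmuA ⊗ idA ⊗ idH ⊗ idH ⊗ idH)
    ∘ (idA ⊗ idA ⊗ cnu ⊗ idH ⊗ idH) ∘ (idA ⊗ idA ⊗ idH ⊗ cnu ⊗ idH)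
    ∘ (idA ⊗ cnu ⊗ idH ⊗ idA ⊗ idH)) shat_cocycle.
  (* [T] is the part of the expanded right bracketing before the multiplications in A and the final
     s^; the last three rewrites leave it fixed. *)
  set (T := (idA ⊗ idA ⊗ idA ⊗ cnu ⊗ idH) ∘ (idA ⊗ idA ⊗ cnu ⊗ idA ⊗ idH)
    ∘ (idA ⊗ cnu ⊗ idA ⊗ idA ⊗ idH) ∘ (idA ⊗ idH ⊗ idA ⊗ idA ⊗ shat)
    ∘ (idA ⊗ idH ⊗ idA ⊗ cnu ⊗ idH)).
  symmetry.
  step (fun x => (dmuA ⊗ idH) ∘ (dmuA ⊗ shat) ∘ (idA ⊗ x ⊗ idH)
    ∘ (idA ⊗ idH ⊗ dmuA ⊗ shat) ∘ (idA ⊗ idH ⊗ idA ⊗ cnu ⊗ idH)) cnu_mul.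
  step (fun x => (dmuA ⊗ idH) ∘ (dmuA ⊗ shat) ∘ (idA ⊗ dmuA ⊗ idH ⊗ idH)
    ∘ (idA ⊗ idA ⊗ cnu ⊗ idH) ∘ (idA ⊗ x ⊗ idA ⊗ idH)
    ∘ (idA ⊗ idH ⊗ idA ⊗ idA ⊗ shat) ∘ (idA ⊗ idH ⊗ idA ⊗ cnu ⊗ idH)) cnu_mul.
  step (fun x => (dmuA ⊗ idH) ∘ (x ⊗ shat) ∘ (idA ⊗ dmuA ⊗ idA ⊗ idH ⊗ idH) ∘ T)
    (equiv_sym muA_assoc).
  step (fun x => (dmuA ⊗ idH) ∘ (dmuA ⊗ shat) ∘ (x ⊗ idA ⊗ idH ⊗ idH) ∘ T)
    (equiv_sym muA_assoc).
  step (fun x => (x ⊗ idH) ∘ (dmuA ⊗ idA ⊗ shat) ∘ (dmuA ⊗ idA ⊗ idA ⊗ idH ⊗ idH) ∘ T)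
    muA_assoc.
  string.
Qed.

End CocycleToAlgebra.

(** * From an associative unital multiplication to a cocycle *)

Section AlgebraToCocycle.

Hypothesis assoc : msigma ∘ (msigma ⊗ idA ⊗ idH) ≈ msigma ∘ (idA ⊗ idH ⊗ msigma).
Hypothesis unitr : msigma ∘ (idA ⊗ idH ⊗ detaA ⊗ deta) ≈ idA ⊗ idH.

Lemma shat_unitr : shat ∘ (idH ⊗ deta) ≈ detaA ⊗ idH.
Proof.
  step (fun x => x ∘ (idH ⊗ deta)) (equiv_sym msigma_unit_AA).
  step (fun x => x ∘ (detaA ⊗ idH)) unitr.
  string.
Qed.

Lemma sigma_eta_eta : dsigma ∘ (deta ⊗ deta) ≈ detaA.
Proof.
  step (fun x => x ∘ (deta ⊗ deta)) (equiv_sym eps_shat).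
  step (fun x => (idA ⊗ deps) ∘ x ∘ deta) shat_unitr.
  step (fun x => detaA ⊗ x) eps_eta.
  string.
Qed.

Lemma shat_cocycle_of_assoc :
  (dmuA ⊗ idH) ∘ (idA ⊗ shat) ∘ (shat ⊗ idH)
  ≈ (dmuA ⊗ idH) ∘ (idA ⊗ shat) ∘ (cnu ⊗ idH) ∘ (idH ⊗ shat).
Proof.
  step (fun x => x ∘ (shat ⊗ idH)) (equiv_sym msigma_unit_A).
  step (fun x => msigma ∘ (x ⊗ detaA ⊗ idH)) (equiv_sym msigma_unit_AA).
  step (fun x => x ∘ (detaA ⊗ idH ⊗ detaA ⊗ idH ⊗ detaA ⊗ idH)) assoc.
  step (fun x => msigma ∘ (detaA ⊗ idH ⊗ x)) msigma_unit_AA.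
  step (fun x => x ∘ (idH ⊗ shat)) msigma_unit_l.
  string.
Qed.

Lemma sigma_cocycle_of_assoc :
  dmuA ∘ (idA ⊗ dsigma) ∘ (shat ⊗ idH)
  ≈ dmuA ∘ (idA ⊗ dsigma) ∘ (cnu ⊗ idH) ∘ (idH ⊗ shat).
Proof.
  step (fun x => dmuA ∘ (idA ⊗ x) ∘ (shat ⊗ idH)) (equiv_sym eps_shat).
  step (fun x => (idA ⊗ deps) ∘ x) shat_cocycle_of_assoc.
  step (fun x => dmuA ∘ (idA ⊗ x) ∘ (cnu ⊗ idH) ∘ (idH ⊗ shat)) eps_shat.
  string.
Qed.

(** The right unit law has made s^(h,1) trivial, so in (ah)(b1) only c^nu survives. *)
Lemma msigma_unit_eta : msigma ∘ (idA ⊗ idH ⊗ idA ⊗ deta) ≈ (dmuA ⊗ idH) ∘ (idA ⊗ cnu).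
Proof.
  step (fun x => (dmuA ⊗ idH) ∘ (dmuA ⊗ x) ∘ (idA ⊗ cnu)) shat_unitr.
  step (fun x => ((x ∘ (dmuA ⊗ idI)) ⊗ idH) ∘ (idA ⊗ cnu)) muA_unitr.
  string.
Qed.

Lemma shat_twisted_module_of_assoc :
  (dmuA ⊗ idH) ∘ (idA ⊗ cnu) ∘ (shat ⊗ idA)
  ≈ (dmuA ⊗ idH) ∘ (idA ⊗ shat) ∘ (cnu ⊗ idH) ∘ (idH ⊗ cnu).
Proof.
  step (fun x => x ∘ (shat ⊗ idA)) (equiv_sym msigma_unit_eta).
  step (fun x => msigma ∘ (x ⊗ idA ⊗ deta)) (equiv_sym msigma_unit_AA).
  step (fun x => x ∘ (detaA ⊗ idH ⊗ detaA ⊗ idH ⊗ idA ⊗ deta)) assoc.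
  step (fun x => msigma ∘ (detaA ⊗ idH ⊗ (x ∘ (detaA ⊗ idH ⊗ idA)))) msigma_unit_eta.
  step (fun x => msigma ∘ (detaA ⊗ idH ⊗ ((x ⊗ idH) ∘ cnu))) muA_unitl.
  step (fun x => x ∘ (idH ⊗ cnu)) msigma_unit_l.
  string.
Qed.

Lemma sigma_twisted_module_of_assoc :
  dmuA ∘ (idA ⊗ dnu) ∘ (shat ⊗ idA)
  ≈ dmuA ∘ (idA ⊗ dsigma) ∘ (cnu ⊗ idH) ∘ (idH ⊗ cnu).
Proof.
  step (fun x => dmuA ∘ (idA ⊗ x) ∘ (shat ⊗ idA)) (equiv_sym eps_cnu).
  step (fun x => (idA ⊗ deps) ∘ x) shat_twisted_module_of_assoc.
  step (fun x => dmuA ∘ (idA ⊗ x) ∘ (cnu ⊗ idH) ∘ (idH ⊗ cnu)) eps_shat.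
  string.
Qed.

End AlgebraToCocycle.

(** * Translation of the cocycle and algebra axioms into diagram equations *)

Lemma cocycle_sigmaE :
  (mul (alg_str A) ∘ (idm _ ⊗' sigma) • (sigma_hat sigma ⊗' idm (F H))
   ≡ mul (alg_str A) ∘ (idm _ ⊗' sigma) • (braid_nu A ⊗' idm (F H))
       • (idm (F H) ⊗' sigma_hat sigma))%moncat
  <-> dmuA ∘ (idA ⊗ dsigma) ∘ (shat ⊗ idH)
      ≈ dmuA ∘ (idA ⊗ dsigma) ∘ (cnu ⊗ idH) ∘ (idH ⊗ shat).
Proof.
  rewrite same_morE. autorewrite with arrows.
  rewrite Arrow_sigma_hat, Arrow_braid_nu. unfold_sem. reflexivity.
Qed.

Lemma cocycle_nuE :
  (mul (alg_str A) ∘ (idm _ ⊗' nu A) • (sigma_hat sigma ⊗' idm (alg_ob A))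
   ≡ mul (alg_str A) ∘ (idm _ ⊗' sigma) • (braid_nu A ⊗' idm (F H))
       • (idm (F H) ⊗' braid_nu A))%moncat
  <-> dmuA ∘ (idA ⊗ dnu) ∘ (shat ⊗ idA)
      ≈ dmuA ∘ (idA ⊗ dsigma) ∘ (cnu ⊗ idH) ∘ (idH ⊗ cnu).
Proof.
  rewrite same_morE. autorewrite with arrows.
  rewrite Arrow_sigma_hat, Arrow_braid_nu. unfold_sem. reflexivity.
Qed.

Lemma cocycle_unitE :
  (sigma ∘ (etaH H ⊗' etaH H) ≡ eta (alg_str A))%moncat
  <-> dsigma ∘ (deta ⊗ deta) ≈ detaA.
Proof. rewrite same_morE. autorewrite with arrows. reflexivity. Qed.

Lemma mu_sigma_algebraE :
  is_algebra (AlgData (mu_sigma sigma) (eta_sigma A)) <->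
  msigma ∘ (msigma ⊗ idA ⊗ idH) ≈ msigma ∘ (idA ⊗ idH ⊗ msigma) /\
  msigma ∘ (detaA ⊗ deta ⊗ idA ⊗ idH) ≈ idA ⊗ idH /\
  msigma ∘ (idA ⊗ idH ⊗ detaA ⊗ deta) ≈ idA ⊗ idH.
Proof.
  (* Splits the equivalence componentwise, so that one script translates all three axioms. *)
  assert (Q : forall P1 P2 P3 Q1 Q2 Q3 : Prop, (P1 <-> Q1) -> (P2 <-> Q2) -> (P3 <-> Q3) ->
    (P1 /\ P2 /\ P3 <-> Q1 /\ Q2 /\ Q3)) by tauto.
  transitivity (let m := mu_sigma sigma in let e := eta_sigma A in
    (m ∘ (m ⊗' idm _) ≡ m ∘ (idm _ ⊗' m) /\
     m ∘ (e ⊗' idm _) ≡ idm (A ⊗ F H) /\ m ∘ (idm _ ⊗' e) ≡ idm (A ⊗ F H))%moncat).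
  { split; [now intros [] | now intros (? & ? & ?)]. }
  apply Q; rewrite same_morE; autorewrite with arrows;
    rewrite Arrow_mu_sigma, ?Arrow_eta_sigma; unfold_sem; rewrite ?atenA; reflexivity.
Qed.

Lemma conv_inverse_lE :
  convolution (coalgHH H) sigma' sigma
    = (eta (alg_str A) ∘ eps (coalgHH H))%moncat ->
  dmuA ∘ (dsigma' ⊗ dsigma) ∘ DeltaHH ≈ detaA ∘ (deps ⊗ deps).
Proof. unfold convolution. intros E. from_eq E. Qed.

End CrossedProduct.

Theorem proposition2p8
  (C D : strict_moncat) (D_eq : has_equalizers D)
  (F : strict_monfunctor C D) (c : left_braiding F)
  (H : bialgebra c) (A : measuring H)
  (sigma : hom (F H ⊗ F H) A)
  (sigma_inv : conv_invertible (coalgHH H) sigma) :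
  is_cocycle sigma <->
  is_algebra (AlgData (mu_sigma sigma) (eta_sigma A)).
Proof.
  pose proof sigma_inv as [sigma' [_ inv_l]]. apply conv_inverse_lE in inv_l.
  rewrite (mu_sigma_algebraE sigma sigma'). split.
  - intros [_ E1 E2 E3].
    apply (cocycle_sigmaE sigma sigma') in E1.
    apply (cocycle_nuE sigma sigma') in E2.
    apply (cocycle_unitE sigma sigma') in E3.
    repeat split.
    + now apply msigma_assoc.
    + now apply msigma_unitl.
    + now apply msigma_unitr.
  - intros (assoc & unitl & unitr). split; [exact sigma_inv | | |].
    + now apply (cocycle_sigmaE sigma sigma'), sigma_cocycle_of_assoc.
    + now apply (cocycle_nuE sigma sigma'), sigma_twisted_module_of_assoc.
    + now apply (cocycle_unitE sigma sigma'), sigma_eta_eta.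
Qed.
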